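(* For a parameter $t$ let $$F=x^4+a_1x^3+a_2x^2+a_3x+a_4,\quad G=x^5+b_1x^4+b_2x^3+b_3x^2+b_4x+b_5,\quad H=x^3+c_1x^2+c_2x+c_3,$$ with $$\begin{aligned} a_1&=4(3t^4+9t^3+43t^2+40t+12),\\ a_2&=6(182t^6+728t^5+2373t^4+3584t^3+2632t^2+960t+144),\\ a_3&=4(t+1)(8t^2+7t+2)(1029t^5+3246t^4+9608t^3+10224t^2+4752t+864),\\ a_4&=(5t+6)(8t^2+7t+2)^2(1029t^5+3246t^4+9608t^3+10224t^2+4752t+864),\\ b_1&=-\tfrac15(4t^4+12t^3-869t^2-892t-276),\\ b_2&=-\tfrac15(448t^6+1756t^5-59175t^4-123710t^3-101900t^2-39144t-6048),\\ b_3&=-\tfrac15(8t^2+7t+2)(2352t^6+9399t^5-256240t^4-577360t^3-506160t^2-204336t-32832),\\ b_4&=-\tfrac25(8t^2+7t+2)^2(56t^2+79t+34)(49t^4+132t^3-5184t^2-4752t-1296),\\ b_5&=-\tfrac25(8t^2+7t+2)^3(49t^2+76t+36)(49t^4+132t^3-5184t^2-4752t-1296),\\ c_1&=\tfrac13(100t^4+300t^3+507t^2+388t+108),\\ c_2&=\tfrac13(5t+6)(8t^2+7t+2)(140t^3+307t^2+308t+108),\\ c_3&=\tfrac13(5t+6)^2(8t^2+7t+2)^2(49t^2+76t+36). \end{aligned}$$ Then for generic $t$ (all but finitely many $t\in\mathbb{C}$) there are a nonzero constant $C_0$ (depending on $t$ but not on $x$) and a monic polynomial $P$ in $x$ of degree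 $10$ such that the rational function $$\varphi_{20}(x)=C_0\frac{F^5}{G^3H}\qquad\text{satisfies}\qquad \varphi_{20}(x)-1=C_0\frac{P^2}{G^3H},$$ and $\varphi_{20}:\mathbb{P}^1_x\to\mathbb{P}^1_z$ is an almost Belyi covering of degree $20$ with ramification pattern $$R_4\big(5+5+5+5\,|\,2+2+2+2+2+2+2+2+2+2\,|\,3+3+3+3+3+2+1+1+1\big),$$ the point of ramification order $2$ above $z=\infty$ being $x=\infty$, and the extra ramification point being $x=0$.
   Context: An almost Belyi covering is a rational map $\varphi:\mathbb{P}^1_x\to\mathbb{P}^1_z$ such that all its ramified points, except exactly one simply ramified point (ramification order $2$), lie above $\{0,1,\infty\}\subset\mathbb{P}^1_z$; the exceptional point lies above a fourth point of $\mathbb{P}^1_z\setminus\{0,1,\infty\}$ and is called the extra ramification point. For partitions $P_1,P_2,P_3$ of $n$, an almost Belyi covering of degree $n$ has ramification pattern $R_4(P_1\,|\,P_2\,|\,P_3)$ if the ramification orders of the points above $z=0$, $z=1$, $z=\infty$ are given, respectively, by $P_1,P_2,P_3$ (the fourth ramified fiber then has pattern $2+1+\cdots+1$). *)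

(* Defs.v *)
From HB Require Import structures.
From mathcomp Require Import all_boot all_order all_algebra.
From mathcomp Require Export reals.
From mathcomp Require Export complex.

Set Implicit Arguments.
Unset Strict Implicit.
Unset Printing Implicit Defensive.

Import GRing.Theory.
Local Open Scope ring_scope.
Local Open Scope quotient_scope.

Notation "x %:F" := (@FracField.tofrac _ x) : ring_scope.

(* Points of the projective line over K: [Some a] is the affine point a and
   [None] is the point at infinity. *)
Notation P1 K := (option K).

Section RationalMaps.
Variable K : fieldType.
Implicit Types (f : {fraction {poly K}}) (p q : P1 K).

(* Numerator and denominator in lowest terms; the pair is only defined up to a
   common nonzero scalar, which nothing below depends on. *)
Definition rnum f : {poly K} :=
  \n_(repr f) %/ gcdp \n_(repr f) \d_(repr f).
Definition rden f : {poly K} :=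
  \d_(repr f) %/ gcdp \n_(repr f) \d_(repr f).

(* Degree of f as a self-map of the projective line. *)
Definition rdeg f : nat := (maxn (size (rnum f)) (size (rden f))).-1.

(* Value of f at a point; at infinity it is the limit of the quotient of the
   two polynomials, i.e. the ratio of their coefficients of degree
   [(size (rden f)).-1] unless the numerator has larger degree. *)
Definition reval f p : P1 K :=
  match p with
  | Some a =>
      if root (rden f) a then None else Some ((rnum f).[a] / (rden f).[a])
  | None =>
      if (size (rden f) < size (rnum f))%N then None
      else Some ((rnum f)`_(size (rden f)).-1 / lead_coef (rden f))
  end.

(* Order of vanishing of f at a point (negative at a pole), with respect to
   the local parameters x - a and 1/x; meaningful for nonzero f. *)
Definition rord f p : int :=
  match p with
  | Some a => (mup a (rnum f))%:Z - (mup a (rden f))%:Z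
  | None => (size (rden f))%:Z - (size (rnum f))%:Z
  end.

(* Ramification order of f at p, for nonconstant f: the pole order of f at p,
   or the order of vanishing of f - f(p) at p. *)
Definition ramord f p : nat :=
  match reval f p with
  | Some z => absz (rord (f - z%:P%:F) p)
  | None => absz (rord f p)
  end.

(* The points above z are listed without repetition by [s]. *)
Definition fiber_pattern f (z : P1 K) (lambda : seq nat) : Prop :=
  exists s : seq (P1 K),
    [/\ uniq s, forall p, (p \in s) = (reval f p == z)
      & perm_eq [seq ramord f p | p <- s] lambda].

Definition belyi_points : seq (P1 K) := [:: Some 0; Some 1; None].

(* q is the only ramified point of f not lying above 0, 1, infinity, and it is
   simply ramified. *)
Definition extra_ramification_point f q : Prop :=
  [/\ reval f q \notin belyi_points, ramord f q = 2%N
    & forall p, (1 < ramord f p)%N -> reval f p \notin belyi_points -> p = q].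

Definition almost_belyi f : Prop :=
  (0 < rdeg f)%N /\ exists q, extra_ramification_point f q.

Definition is_partition (n : nat) (lambda : seq nat) : bool :=
  (0%N \notin lambda) && (sumn lambda == n).

Definition R4_pattern (n : nat) (lambda0 lambda1 lambdaoo : seq nat) f : Prop :=
  all (is_partition n) [:: lambda0; lambda1; lambdaoo] /\
  [/\ almost_belyi f, rdeg f = n, fiber_pattern f (Some 0) lambda0,
      fiber_pattern f (Some 1) lambda1 & fiber_pattern f None lambdaoo].

End RationalMaps.

Section Family.
Variable K : fieldType.
Implicit Type t : K.

(* Literals above 5000 carry an explicit %:R, so that they go through the nat
   parser, which does not expand them in unary. *)

Definition a1 t : K :=
  4 * (3 * t ^+ 4 + 9 * t ^+ 3 + 43 * t ^+ 2 + 40 * t + 12).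
Definition a2 t : K :=
  6 * (182 * t ^+ 6 + 728 * t ^+ 5 + 2373 * t ^+ 4 + 3584 * t ^+ 3
       + 2632 * t ^+ 2 + 960 * t + 144).
Definition a3 t : K :=
  4 * (t + 1) * (8 * t ^+ 2 + 7 * t + 2)
  * (1029 * t ^+ 5 + 3246 * t ^+ 4 + 9608%:R * t ^+ 3 + 10224%:R * t ^+ 2
     + 4752 * t + 864).
Definition a4 t : K :=
  (5 * t + 6) * (8 * t ^+ 2 + 7 * t + 2) ^+ 2
  * (1029 * t ^+ 5 + 3246 * t ^+ 4 + 9608%:R * t ^+ 3 + 10224%:R * t ^+ 2
     + 4752 * t + 864).

Definition b1 t : K :=
  - (1 / 5) * (4 * t ^+ 4 + 12 * t ^+ 3 - 869 * t ^+ 2 - 892 * t - 276).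
Definition b2 t : K :=
  - (1 / 5) * (448 * t ^+ 6 + 1756 * t ^+ 5 - 59175%:R * t ^+ 4
               - 123710%:R * t ^+ 3 - 101900%:R * t ^+ 2 - 39144%:R * t - 6048%:R).
Definition b3 t : K :=
  - (1 / 5) * (8 * t ^+ 2 + 7 * t + 2)
  * (2352 * t ^+ 6 + 9399%:R * t ^+ 5 - 256240%:R * t ^+ 4 - 577360%:R * t ^+ 3
     - 506160%:R * t ^+ 2 - 204336%:R * t - 32832%:R).
Definition b4 t : K :=
  - (2 / 5) * (8 * t ^+ 2 + 7 * t + 2) ^+ 2 * (56 * t ^+ 2 + 79 * t + 34)
  * (49 * t ^+ 4 + 132 * t ^+ 3 - 5184%:R * t ^+ 2 - 4752 * t - 1296).
Definition b5 t : K :=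
  - (2 / 5) * (8 * t ^+ 2 + 7 * t + 2) ^+ 3 * (49 * t ^+ 2 + 76 * t + 36)
  * (49 * t ^+ 4 + 132 * t ^+ 3 - 5184%:R * t ^+ 2 - 4752 * t - 1296).

Definition c1 t : K :=
  1 / 3 * (100 * t ^+ 4 + 300 * t ^+ 3 + 507 * t ^+ 2 + 388 * t + 108).
Definition c2 t : K :=
  1 / 3 * (5 * t + 6) * (8 * t ^+ 2 + 7 * t + 2)
  * (140 * t ^+ 3 + 307 * t ^+ 2 + 308 * t + 108).
Definition c3 t : K :=
  1 / 3 * (5 * t + 6) ^+ 2 * (8 * t ^+ 2 + 7 * t + 2) ^+ 2
  * (49 * t ^+ 2 + 76 * t + 36).

Definition polyF t : {poly K} :=
  'X^4 + a1 t *: 'X^3 + a2 t *: 'X^2 + a3 t *: 'X + (a4 t)%:P.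
Definition polyG t : {poly K} :=
  'X^5 + b1 t *: 'X^4 + b2 t *: 'X^3 + b3 t *: 'X^2 + b4 t *: 'X + (b5 t)%:P.
Definition polyH t : {poly K} :=
  'X^3 + c1 t *: 'X^2 + c2 t *: 'X + (c3 t)%:P.

Definition phi20 (C0 t : K) : {fraction {poly K}} :=
  C0%:P%:F * ((polyF t)%:F ^+ 5 / ((polyG t)%:F ^+ 3 * (polyH t)%:F)).

End Family.

(* Main.v *)
Require Import Defs.
From HB Require Import structures.
From mathcomp Require Import all_boot all_order all_algebra.
From mathcomp Require Import reals complex ring.
Import GRing.Theory Num.Theory.
Local Open Scope ring_scope.

Set Implicit Arguments.
Unset Strict Implicit.
Unset Printing Implicit Defensive.

(** The covering is phi = C0 F^5 / (G^3 H), and everything follows from one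
    logarithmic derivative.  Put N = 5 F' G H - 3 F G' H - F G H', so that
    phi' / phi = N / (F G H).  Two polynomial identities in x and t hold:
    N vanishes at x = 0 ([root_critical_poly]), and
    N^2 = 4 x^2 (F^5 - D G^3 H) with D = 1500 t^5 (t + 2)^3
    ([critical_poly_sqr]).  Hence N = 2 x P with P^2 = F^5 - D G^3 H, and with
    C0 = 1 / D this says phi - 1 = C0 P^2 / (G^3 H).

    In characteristic 0 the ramification order of p / q at an affine point is
    one more than the order of vanishing of the Wronskian p' q - p q', at
    poles as well as elsewhere ([ramord_quotient]).  Here the Wronskian is
    2 C0 x P F^4 G^2.  Provided that F is coprime to G H and that none of
    F, G, H, P vanishes at 0, comparing orders determines all multiplicities:
    at a root of F of multiplicity m one gets 5 m = 4 m + 1, at a root of P one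
    gets 2 m = m + 1, and at a root of G H the multiplicity m of G H satisfies
    m + 2 g = 2 g + 1, where g is that of G.  So F, P and G H have simple
    roots, the fibers above 0, 1 and infinity are read off, and the only
    remaining zero of the Wronskian is the simple one at x = 0.

    The provisos are the nonvanishing of polynomials in t (for coprimality, of
    a resultant), so each holds outside a finite set as soon as it holds for
    one parameter; the parameter t = -1 serves for all of them. *)

(** * Rational maps in lowest terms *)

Section LowestTerms.
Variable K : fieldType.
Implicit Types (p q : {poly K}) (f : {fraction {poly K}}).

Lemma fraction_repr f : f = (\n_(repr f))%:F / (\d_(repr f))%:F.
Proof.
have d0 : (\d_(repr f))%:F != 0 by rewrite tofrac_eq0 denom_ratioP.
apply: (canRL (mulfK d0)).
rewrite -{1}[f]reprK !piE; apply/eqP.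
rewrite piE /FracField.equivf !numden_Ratio ?mulr1 ?oner_eq0 ?denom_ratioP //.
by rewrite mulrC.
Qed.

(** The numerator and denominator chosen by [repr] are unknown, but two coprime
    pairs with the same quotient are proportional. *)
Lemma lowest_terms p q : coprimep p q -> q != 0 ->
  exists2 c, c != 0 & rnum (p%:F / q%:F) = c *: p /\ rden (p%:F / q%:F) = c *: q.
Proof.
move=> cpq q0; set f := _ / _; set n := \n_(repr f); set d := \d_(repr f).
have d0 : d != 0 by apply: denom_ratioP.
have e : n * q = p * d.
  apply/eqP; rewrite -tofrac_eq !tofracM.
  by rewrite -eqr_div ?tofrac_eq0 // -[X in X == _]fraction_repr.
have cnd : coprimep (rnum f) (rden f) by apply: coprimep_div_gcd; rewrite d0 orbT.
have g0 : gcdp n d != 0 by rewrite gcdp_eq0 negb_and d0 orbT.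
have {e} e : rnum f * q = p * rden f.
  apply: (mulIf g0); rewrite mulrAC -(mulrA p).
  by rewrite !divpK ?dvdp_gcdl ?dvdp_gcdr.
have dq : rden f %= q.
  have cdn : coprimep (rden f) (rnum f) by rewrite coprimep_sym.
  have cqp : coprimep q p by rewrite coprimep_sym.
  rewrite /eqp -(Gauss_dvdpr q cdn) e dvdp_mull //=.
  by rewrite -(Gauss_dvdpr (rden f) cqp) -e dvdp_mull.
case/eqpP: dq => -[c1 c2] /andP[/= c10 c20] dq.
have dE : rden f = (c2 / c1) *: q.
  by rewrite mulrC -scalerA -dq scalerA mulVf // scale1r.
exists (c2 / c1); first by rewrite mulf_neq0 ?invr_eq0.
split=> //; apply: (mulIf q0); rewrite e dE.
by rewrite -scalerAr scalerAl.
Qed.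

Lemma mupZ (a c : K) p : c != 0 -> mup a (c *: p) = mup a p.
Proof. by move=> c0; rewrite -mul_polyC mupMr // rootC. Qed.

Lemma mupN (a : K) p : mup a (- p) = mup a p.
Proof. by rewrite -scaleN1r mupZ // oppr_eq0 oner_eq0. Qed.

Lemma reval_quotient p q (a : K) : coprimep p q -> q != 0 ->
  reval (p%:F / q%:F) (Some a) = if root q a then None else Some (p.[a] / q.[a]).
Proof.
move=> cpq q0; have [c c0 [nE dE]] := lowest_terms cpq q0.
by rewrite /reval nE dE rootZ // !hornerZ -mulf_div divff // mul1r.
Qed.

Lemma reval_quotient_infty p q : coprimep p q -> (0 < size q < size p)%N ->
  reval (p%:F / q%:F) None = None.
Proof.
move=> cpq /andP[q0 qp]; rewrite size_poly_gt0 in q0.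
have [c c0 [nE dE]] := lowest_terms cpq q0.
by rewrite /reval nE dE !size_scale // qp.
Qed.

Lemma rord_quotient p q (a : K) : coprimep p q -> q != 0 ->
  rord (p%:F / q%:F) (Some a) = (mup a p)%:Z - (mup a q)%:Z.
Proof.
move=> cpq q0; have [c c0 [nE dE]] := lowest_terms cpq q0.
by rewrite /rord nE dE !mupZ.
Qed.

Lemma ramord_quotient_infty p q : coprimep p q -> (0 < size q < size p)%N ->
  ramord (p%:F / q%:F) None = (size p - size q)%N.
Proof.
move=> cpq /andP[q0 qp]; rewrite /ramord reval_quotient_infty ?q0 ?qp //.
rewrite size_poly_gt0 in q0.
have [c c0 [nE dE]] := lowest_terms cpq q0.
by rewrite /rord nE dE !size_scale // distnEr // ltnW.
Qed.

Lemma rdeg_quotient p q : coprimep p q -> q != 0 ->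
  rdeg (p%:F / q%:F) = (maxn (size p) (size q)).-1.
Proof.
move=> cpq q0; have [c c0 [nE dE]] := lowest_terms cpq q0.
by rewrite /rdeg nE dE !size_scale.
Qed.

End LowestTerms.

(** * Ramification and Wronskians *)

Definition wronskian (K : nzRingType) (p q : {poly K}) := p^`() * q - p * q^`().

Lemma wronskianN (K : comNzRingType) (p q : {poly K}) :
  wronskian q p = - wronskian p q.
Proof. by rewrite /wronskian opprB mulrC [q * _]mulrC. Qed.

(** This is why a single polynomial controls all the fibers: up to the square of
    q the Wronskian is the derivative of p / q, which does not see an additive
    constant. *)
Lemma wronskian_subZ (K : comNzRingType) (p q : {poly K}) z :
  wronskian (p - z *: q) q = wronskian p q.
Proof.
rewrite /wronskian derivB derivZ !mulrBl -!scalerAl opprB.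
by rewrite [q^`() * q]mulrC addrA subrK.
Qed.

Section Ramification.
Variable K : numFieldType.
Implicit Types p q : {poly K}.

(** If p = u (x - a)^(m+1) with u(a) != 0, then the Wronskian is (x - a)^m times
    a polynomial with value (m+1) u(a) q(a) at a, nonzero in characteristic 0. *)
Lemma mup_wronskian p q (a : K) : root p a -> ~~ root q a ->
  wronskian p q != 0 -> mup a p = (mup a (wronskian p q)).+1.
Proof.
move=> pa qa w0.
have p0 : p != 0.
  by apply: contraNneq w0 => ->; rewrite /wronskian deriv0 !mul0r subr0.
have [m [u ua pE]] := multiplicity_XsubC p a; rewrite p0 /= in ua.
case: m => [|m] in pE *.
  by move: pa; rewrite pE mulr1 (negPf ua).
have mp : mup a p = m.+1 by rewrite pE mupMr // mup_XsubCX eqxx.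
pose v := (u^`() * q - u * q^`()) * ('X - a%:P) + m.+1%:R *: (u * q).
have wE : wronskian p q = v * ('X - a%:P) ^+ m.
  rewrite /wronskian pE derivM deriv_exp derivXsubC mul1r /v exprS /=.
  rewrite -mulr_natr -mul_polyC rmorph_nat.
  have alg (A : comNzRingType) (x x' y y' k l lm : A) :
      (x' * (l * lm) + x * (lm * k)) * y - x * (l * lm) * y' =
      ((x' * y - x * y') * l + k * (x * y)) * lm by ring.
  exact: alg.
rewrite mp wE mupMr ?mup_XsubCX ?eqxx //.
rewrite /root hornerD !hornerM hornerXsubC subrr mulr0 add0r hornerZ hornerM.
by rewrite !mulf_neq0 ?pnatr_eq0.
Qed.

(** At a pole this is the previous lemma for q / p; elsewhere it is the previous
    lemma for p - z q, where z is the value of p / q at the point. *)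
Lemma ramord_quotient p q (a : K) : coprimep p q -> wronskian p q != 0 ->
  ramord (p%:F / q%:F) (Some a) = (mup a (wronskian p q)).+1.
Proof.
move=> cpq w0.
have q0 : q != 0.
  by apply: contraNneq w0 => ->; rewrite /wronskian deriv0 !mulr0 subr0.
rewrite /ramord reval_quotient //; case: ifPn => qa.
  have pa : ~~ root p a by apply: coprimep_root qa; rewrite coprimep_sym.
  rewrite rord_quotient // mupNroot // sub0r abszN absz_nat.
  by rewrite (mup_wronskian qa pa) wronskianN ?mupN ?oppr_eq0.
set z := p.[a] / q.[a].
have -> : p%:F / q%:F - z%:P%:F = (p - z *: q)%:F / q%:F.
  have qF : q%:F != 0 by rewrite tofrac_eq0.
  by rewrite tofracB mulrBl -mul_polyC tofracM mulfK.
have cz : coprimep (p - z *: q) q.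
  by rewrite coprimep_sym -mul_polyC addrC -mulNr coprimep_addl_mul coprimep_sym.
have za : root (p - z *: q) a.
  by rewrite /root hornerD hornerN hornerZ divfK ?subrr.
rewrite rord_quotient // (mupNroot qa) subr0 absz_nat.
by rewrite (mup_wronskian za qa) wronskian_subZ.
Qed.

Lemma mup_exp p n (a : K) : p != 0 -> mup a (p ^+ n) = (n * mup a p)%N.
Proof.
move=> p0; elim: n => [|n IHn]; first by rewrite mupNroot // root1.
by rewrite exprS mupM ?expf_neq0 // IHn mulSn.
Qed.

End Ramification.

(** * Fibers described by polynomials with simple roots *)

Section SimpleRoots.
Variable K : numClosedFieldType.
Implicit Types (r : {poly K}) (f : {fraction {poly K}}).

Lemma distinct_roots r : r != 0 -> (forall a, root r a -> mup a r = 1%N) ->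
  exists s : seq K,
    [/\ uniq s, size s = (size r).-1 & forall a, (a \in s) = root r a].
Proof.
move=> r0 simple; have [s rE] := closed_field_poly_normal r.
have l0 : lead_coef r != 0 by rewrite lead_coef_eq0.
have rs a : (a \in s) = root r a by rewrite rE rootZ // root_prod_XsubC.
exists s; split=> //; last by rewrite rE size_scale // size_prod_XsubC.
apply: count_mem_uniq => a; rewrite -mu_prod_XsubC -(mupZ _ _ l0) -rE rs.
by have [ra|ra] := boolP (root r a); [apply: simple | apply: mupNroot].
Qed.

Lemma fiber_pattern_simple f r z e :
  r != 0 -> (forall a, root r a -> mup a r = 1%N) ->
  reval f None != Some z ->
  (forall a, (reval f (Some a) == Some z) = root r a) ->
  (forall a, root r a -> ramord f (Some a) = e) ->
  fiber_pattern f (Some z) (nseq (size r).-1 e).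
Proof.
move=> r0 simple finfty fr ram.
have [s [us <- sr]] := distinct_roots r0 simple.
exists [seq Some a | a <- s]; split.
- by rewrite map_inj_uniq // => ? ? [].
- case=> [a|]; last first.
    by rewrite (negPf finfty); apply/mapP => -[].
  by rewrite fr mem_map ?sr // => ? ? [].
- rewrite -[size s](size_map Some) -[size _](size_map (ramord f)).
  apply/permP => b; congr (count b _); apply/all_pred1P.
  apply/allP => _ /mapP[_ /mapP[a sa ->] ->].
  by rewrite /= ram // -sr.
Qed.
End SimpleRoots.

(** * The covering attached to a solution of the two identities *)

Lemma coprimep_nroot (K : fieldType) (p q : {poly K}) a :
  coprimep p q -> root p a -> ~~ root q a.
Proof. exact: coprimep_root. Qed.

Lemma root_expS (K : fieldType) (p : {poly K}) n a :
  root (p ^+ n.+1) a = root p a.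
Proof. by rewrite !rootE horner_exp expf_eq0. Qed.

Lemma mulSn_eqS e m : (e.+1 * m = (e * m).+1 -> m = 1)%N.
Proof. by rewrite mulSn -addn1 addnC => /addnI. Qed.

Lemma size_expS (K : idomainType) (p : {poly K}) n :
  p != 0 -> size (p ^+ n) = ((size p).-1 * n).+1.
Proof. by move=> p0; rewrite -size_exp prednK // size_poly_gt0 expf_neq0. Qed.

(** The numerator of the logarithmic derivative of F^5 / (G^3 H) over the
    denominator F G H. *)
Definition critical_poly (R : nzRingType) (F G H : {poly R}) :=
  5 * F^`() * G * H - 3 * F * G^`() * H - F * G * H^`().

Lemma horner_critical_poly (R : comNzRingType) (F G H : {poly R}) x :
  (critical_poly F G H).[x] = 5 * F^`().[x] * G.[x] * H.[x]
    - 3 * F.[x] * G^`().[x] * H.[x] - F.[x] * G.[x] * H^`().[x].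
Proof.
by rewrite /critical_poly -!(rmorph_nat polyC)
  !(hornerD, hornerN, hornerM, hornerC).
Qed.

Section Covering.
Variables (K : numClosedFieldType) (F G H P : {poly K}) (C0 : K).
Hypothesis C0_neq0 : C0 != 0.
Hypotheses (sizeF : size F = 5%N) (sizeG : size G = 6%N) (sizeH : size H = 4%N)
  (sizeP : size P = 11%N).
Hypotheses (F0 : ~~ root F 0) (G0 : ~~ root G 0) (H0 : ~~ root H 0)
  (P0 : ~~ root P 0).
Hypothesis coprimeF : coprimep F (G * H).
Hypothesis square_identity : C0 *: F ^+ 5 - G ^+ 3 * H = C0 *: P ^+ 2.
Hypothesis critical_identity : critical_poly F G H = 2 *: ('X * P).

Let num := C0 *: F ^+ 5.
Let den := G ^+ 3 * H.
Let phi := num%:F / den%:F.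

Let F_neq0 : F != 0. Proof. by rewrite -size_poly_eq0 sizeF. Qed.
Let G_neq0 : G != 0. Proof. by rewrite -size_poly_eq0 sizeG. Qed.
Let H_neq0 : H != 0. Proof. by rewrite -size_poly_eq0 sizeH. Qed.
Let P_neq0 : P != 0. Proof. by rewrite -size_poly_eq0 sizeP. Qed.
Let den_neq0 : den != 0.
Proof. by rewrite mulf_neq0 ?expf_neq0. Qed.

Lemma coprime_num_den : coprimep num den.
Proof.
move: coprimeF; rewrite coprimepMr => /andP[cG cH].
by rewrite coprimepZl // coprimepMr !coprimep_expl // coprimep_expr.
Qed.

(** By the square identity, a common root of P and the denominator would also be
    a root of the numerator. *)
Lemma coprime_P_den : coprimep P den.
Proof.
have := coprime_num_den.
have -> : num = C0 *: P ^+ 2 + den by rewrite -square_identity subrK.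
rewrite coprimep_sym addrC -[X in X + _]mul1r coprimep_addl_mul.
by rewrite coprimepZr // coprimep_pexpr // coprimep_sym.
Qed.

Lemma coprime_F_P : coprimep F P.
Proof.
rewrite coprimep_sym; apply/Pdiv.ClosedField.coprimepP => a Pa.
apply/negP => Fa; have /negP[] := coprimep_root coprime_P_den Pa.
have -> : den = num - C0 *: P ^+ 2 by rewrite -square_identity opprB addrCA subrr addr0.
rewrite /num hornerD hornerN !hornerZ !horner_exp (rootP Pa) (eqP Fa).
by rewrite !expr0n !mulr0 subrr.
Qed.

(** Differentiating, the Wronskian is C0 F^4 G^2 times the critical
    polynomial. *)
Lemma wronskian_num_den :
  wronskian num den = (2 * C0) *: ('X * P * F ^+ 4 * G ^+ 2).
Proof.
have alg (A : comNzRingType) (f f' g g' h h' x q c : A) :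
    5 * f' * g * h - 3 * f * g' * h - f * g * h' = 2 * (x * q) ->
    c * (f ^+ 4 * f' *+ 5) * (g ^+ 3 * h) -
    c * f ^+ 5 * (g ^+ 2 * g' *+ 3 * h + g ^+ 3 * h') =
    2 * c * (x * q * f ^+ 4 * g ^+ 2).
  move=> e; transitivity (c * f ^+ 4 * g ^+ 2 * (2 * (x * q))); last by ring.
  by rewrite -e; ring.
rewrite /wronskian /num /den derivZ [(_ * H)^`()]derivM !deriv_exp /=.
rewrite -!mul_polyC polyCM.
rewrite (rmorph_nat polyC 2) [F^`() * _]mulrC [G^`() * _]mulrC.
by apply: alg; rewrite -(rmorph_nat polyC 2) mul_polyC; apply: critical_identity.
Qed.

Let C2_neq0 : 2 * C0 != 0. Proof. by rewrite mulf_neq0 ?pnatr_eq0. Qed.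

Lemma wronskian_neq0 : wronskian num den != 0.
Proof.
rewrite wronskian_num_den scaler_eq0 negb_or C2_neq0.
by rewrite !mulf_neq0 ?expf_neq0 ?polyX_eq0.
Qed.

Lemma mup_wronskian_num_den a :
  mup a (wronskian num den) =
  (mup a 'X + mup a P + 4 * mup a F + 2 * mup a G)%N.
Proof.
rewrite wronskian_num_den mupZ // mupM 1?mupM 1?[mup a (_ * P)]mupM ?mup_exp //;
  by rewrite ?mulf_neq0 ?expf_neq0 ?polyX_eq0.
Qed.

Lemma mup_polyX a : a != 0 -> mup a ('X : {poly K}) = 0%N.
Proof. by move=> a0; rewrite mupNroot // /root hornerX. Qed.

Lemma root_neq0 (r : {poly K}) a : ~~ root r 0 -> root r a -> a != 0.
Proof. by move=> r0; apply: contraTneq => ->. Qed.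

Lemma rootF_others a : root F a -> [/\ a != 0, ~~ root P a, ~~ root G a & ~~ root H a].
Proof.
move=> Fa; have := coprimep_nroot coprimeF Fa; have := coprimep_nroot coprime_F_P Fa.
by rewrite rootM negb_or (root_neq0 F0 Fa) => -> /andP[-> ->].
Qed.

Lemma root_den a : root den a = root (G * H) a.
Proof. by rewrite /den rootM root_expS -rootM. Qed.

Lemma rootP_others a : root P a -> [/\ a != 0, ~~ root F a, ~~ root G a & ~~ root H a].
Proof.
move=> Pa; have := coprimep_nroot coprime_P_den Pa.
have cPF : coprimep P F by rewrite coprimep_sym coprime_F_P.
have := coprimep_nroot cPF Pa.
by rewrite root_den rootM negb_or (root_neq0 P0 Pa) => -> /andP[-> ->].
Qed.

Lemma rootGH_others a : root (G * H) a -> [/\ a != 0, ~~ root F a & ~~ root P a].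
Proof.
move=> Ga; have cGF : coprimep (G * H) F by rewrite coprimep_sym.
have Pa : ~~ root P a.
  by apply/negP => /(coprimep_nroot coprime_P_den); rewrite root_den Ga.
rewrite (coprimep_nroot cGF Ga) Pa; split=> //.
by apply: root_neq0 Ga; rewrite rootM negb_or G0.
Qed.

(** The order of F^5 at a root of F exceeds that of the Wronskian by one, and
    there the Wronskian vanishes only through F^4: 5 m = 4 m + 1. *)
Lemma mup_rootF a : root F a -> mup a F = 1%N.
Proof.
move=> Fa; have [a0 Pa Ga Ha] := rootF_others Fa.
have numa : root num a by rewrite rootZ // root_expS.
have dena : ~~ root den a by rewrite root_den rootM negb_or Ga.
have := mup_wronskian numa dena wronskian_neq0.
rewrite mup_wronskian_num_den mup_polyX // (mupNroot Pa) (mupNroot Ga).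
rewrite mupZ // mup_exp //.
by rewrite !muln0 !addn0 !add0n => /mulSn_eqS.
Qed.

(** The same comparison for the fiber above 1, whose polynomial is C0 P^2:
    2 m = m + 1. *)
Lemma mup_rootP a : root P a -> mup a P = 1%N.
Proof.
move=> Pa; have [a0 Fa Ga Ha] := rootP_others Pa.
have fibE : num - 1 *: den = C0 *: P ^+ 2 by rewrite scale1r.
have numa : root (num - 1 *: den) a by rewrite fibE rootZ // root_expS.
have dena : ~~ root den a by rewrite root_den rootM negb_or Ga.
have := mup_wronskian numa dena; rewrite wronskian_subZ => /(_ wronskian_neq0).
rewrite fibE mup_wronskian_num_den mup_polyX // (mupNroot Fa) (mupNroot Ga).
rewrite mupZ // mup_exp //.
by rewrite !muln0 !addn0 !add0n => e; apply: (@mulSn_eqS 1); rewrite mul1n.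
Qed.

(** The same comparison at the poles, whose polynomial is (G H) G^2 while the
    Wronskian vanishes through G^2.  This gives at once that G and H have simple
    roots and no common root. *)
Lemma mup_rootGH a : root (G * H) a -> mup a (G * H) = 1%N.
Proof.
move=> Ga; have [a0 Fa Pa] := rootGH_others Ga.
have dena : root den a by rewrite root_den.
have numa : ~~ root num a by rewrite rootZ // root_expS.
have := mup_wronskian dena numa; rewrite wronskianN oppr_eq0 => /(_ wronskian_neq0).
rewrite mupN mup_wronskian_num_den mup_polyX // (mupNroot Fa) (mupNroot Pa).
rewrite muln0 !add0n.
have -> : den = G * H * G ^+ 2 by rewrite mulrAC -exprS.
rewrite mupM ?mulf_neq0 ?expf_neq0 // (mup_exp 2) //.
by rewrite -[(2 * _).+1]addn1 addnC => /addnI.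
Qed.

Lemma mup_rootG a : root G a -> mup a G = 1%N /\ ~~ root H a.
Proof.
move=> Ga; have := @mup_rootGH a; rewrite rootM Ga mupM // => /(_ isT).
have : (0 < mup a G)%N by rewrite -XsubC_dvd // dvdp_XsubCl.
case: (mup a G) => // -[|m] //; rewrite add1n => _ [Ha].
by split=> //; rewrite -dvdp_XsubCl XsubC_dvd // Ha.
Qed.

Lemma mup_rootH a : root H a -> mup a H = 1%N /\ ~~ root G a.
Proof.
move=> Ha; have Ga : ~~ root G a by apply: contraL Ha => /mup_rootG[].
by rewrite -(mup_rootGH (a := a)) ?rootM ?Ha ?orbT // mupMr.
Qed.

Lemma reval_zero a : (reval phi (Some a) == Some 0) = root F a.
Proof.
rewrite reval_quotient ?coprime_num_den // root_den.
case: ifPn => [/rootGH_others[_ /negPf -> //]|Ga].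
rewrite -[LHS]/(num.[a] / den.[a] == 0) mulf_eq0 invr_eq0 -!rootE.
by rewrite root_den (negPf Ga) orbF rootZ // root_expS.
Qed.

Lemma reval_one a : (reval phi (Some a) == Some 1) = root P a.
Proof.
rewrite reval_quotient ?coprime_num_den // root_den.
case: ifPn => [/rootGH_others[_ _ /negPf -> //]|Ga].
have d0 : den.[a] != 0 by rewrite -rootE root_den.
rewrite -[LHS]/(num.[a] / den.[a] == 1) -(inj_eq (mulIf d0)) divfK // mul1r -subr_eq0.
by rewrite -hornerN -hornerD square_identity -rootE rootZ // root_expS.
Qed.

Lemma reval_pole a : (reval phi (Some a) == None) = root (G * H) a.
Proof.
by rewrite reval_quotient ?coprime_num_den // root_den; case: ifP.
Qed.

Lemma size_num : size num = 21%N.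
Proof. by rewrite size_scale // size_expS // sizeF. Qed.

Lemma size_den : size den = 19%N.
Proof. by rewrite size_mul ?expf_neq0 // size_expS // sizeG sizeH. Qed.

Lemma reval_infty : reval phi None = None.
Proof. by rewrite reval_quotient_infty ?coprime_num_den // size_num size_den. Qed.

Lemma ramord_infty : ramord phi None = 2%N.
Proof.
by rewrite ramord_quotient_infty ?coprime_num_den // size_num size_den.
Qed.

(** Read on the factorization of the Wronskian, this is the whole ramification
    of the covering away from infinity. *)
Lemma ramord_affine a :
  ramord phi (Some a) = (mup a 'X + mup a P + 4 * mup a F + 2 * mup a G).+1.
Proof.
by rewrite ramord_quotient ?coprime_num_den ?wronskian_neq0 // mup_wronskian_num_den.
Qed.

Lemma fiber_zero : fiber_pattern phi (Some 0) [:: 5; 5; 5; 5]%N.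
Proof.
have -> : [:: 5; 5; 5; 5]%N = nseq (size F).-1 5 by rewrite sizeF.
apply: fiber_pattern_simple => // [a|||a Fa]; rewrite ?reval_infty //.
- exact: mup_rootF.
- exact: reval_zero.
- have [a0 Pa Ga _] := rootF_others Fa.
  by rewrite ramord_affine mup_polyX // (mupNroot Pa) (mupNroot Ga) mup_rootF.
Qed.

Lemma fiber_one : fiber_pattern phi (Some 1) [:: 2; 2; 2; 2; 2; 2; 2; 2; 2; 2]%N.
Proof.
have -> : [:: 2; 2; 2; 2; 2; 2; 2; 2; 2; 2]%N = nseq (size P).-1 2 by rewrite sizeP.
apply: fiber_pattern_simple => // [a|||a Pa]; rewrite ?reval_infty //.
- exact: mup_rootP.
- exact: reval_one.
- have [a0 Fa Ga _] := rootP_others Pa.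
  by rewrite ramord_affine mup_polyX // (mupNroot Fa) (mupNroot Ga) mup_rootP.
Qed.

Lemma fiber_infty : fiber_pattern phi None [:: 3; 3; 3; 3; 3; 2; 1; 1; 1]%N.
Proof.
have [sG [uG szG sGE]] := distinct_roots G_neq0 (fun a Ga => (mup_rootG Ga).1).
have [sH [uH szH sHE]] := distinct_roots H_neq0 (fun a Ha => (mup_rootH Ha).1).
have SomeI : injective (@Some K) by move=> ? ? [].
have NoneS s : (None \in [seq Some a | a : K <- s]) = false.
  by apply/mapP => -[].
exists ([seq Some a | a <- sG] ++ None :: [seq Some a | a <- sH]); split.
- rewrite cat_uniq /= !map_inj_uniq // uG uH NoneS /= NoneS /= andbT.
  apply/hasPn => _ /mapP[a aH ->]; rewrite mem_map // sGE.
  by rewrite sHE in aH; have [] := mup_rootH aH.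
- case=> [a|]; rewrite mem_cat in_cons.
    by rewrite !mem_map // sGE sHE reval_pole rootM.
  by rewrite reval_infty eqxx orbT.
have -> : [:: 3; 3; 3; 3; 3; 2; 1; 1; 1]%N =
    nseq (size sG) 3 ++ 2%N :: nseq (size sH) 1.
  by rewrite szG szH sizeG sizeH.
rewrite map_cat /= ramord_infty -2!map_comp.
apply/permP => b; congr (count b (_ ++ _ :: _)).
  rewrite -(size_map (ramord phi \o Some)).
  apply/all_pred1P/allP => _ /mapP[a aG ->] /=.
  rewrite sGE in aG; have [a0 Fa Pa] : [/\ a != 0, ~~ root F a & ~~ root P a].
    by apply: rootGH_others; rewrite rootM aG.
  by rewrite ramord_affine mup_polyX // (mupNroot Fa) (mupNroot Pa) (mup_rootG aG).1.
rewrite -(size_map (ramord phi \o Some)).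
apply/all_pred1P/allP => _ /mapP[a aH ->] /=.
rewrite sHE in aH; have [a0 Fa Pa] : [/\ a != 0, ~~ root F a & ~~ root P a].
  by apply: rootGH_others; rewrite rootM aH orbT.
rewrite ramord_affine mup_polyX // (mupNroot Fa) (mupNroot Pa).
by rewrite (mupNroot (mup_rootH aH).2).
Qed.

Lemma extra_point_zero : extra_ramification_point phi (Some 0).
Proof.
split.
- rewrite !inE !negb_or reval_zero reval_one reval_pole F0 P0 /=.
  by rewrite rootM negb_or G0.
- rewrite ramord_affine (mupNroot F0) (mupNroot P0) (mupNroot G0) !muln0 !addn0.
  by rewrite -['X]subr0 -['X - 0]expr1 mup_XsubCX eqxx.
case=> [a|]; last by rewrite reval_infty !inE.
rewrite ramord_affine !inE !negb_or reval_zero reval_one reval_pole rootM negb_or.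
move=> ram /and4P[Fa Pa Ga _]; congr Some; apply/eqP; apply: contraTT ram => a0.
by rewrite mup_polyX // (mupNroot Fa) (mupNroot Pa) (mupNroot Ga).
Qed.

Lemma R4_pattern_phi :
  R4_pattern 20 [:: 5; 5; 5; 5]%N [:: 2; 2; 2; 2; 2; 2; 2; 2; 2; 2]%N
    [:: 3; 3; 3; 3; 3; 2; 1; 1; 1]%N phi.
Proof.
have deg : rdeg phi = 20%N.
  by rewrite rdeg_quotient ?coprime_num_den // size_num size_den.
split=> //; split=> //; [|exact: fiber_zero|exact: fiber_one|exact: fiber_infty].
by rewrite /almost_belyi deg; split=> //; exists (Some 0); apply: extra_point_zero.
Qed.

End Covering.

(** * Conditions that hold for all but finitely many parameters *)

Section Generic.
Variable K : numClosedFieldType.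
Implicit Types f g : K -> K.

Definition polynomial_in f := exists p : {poly K}, forall t, f t = p.[t].

Lemma polynomial_in_cst c : polynomial_in (fun=> c).
Proof. by exists c%:P => t; rewrite hornerC. Qed.

Lemma polynomial_in_id : polynomial_in (fun t => t).
Proof. by exists 'X => t; rewrite hornerX. Qed.

Lemma polynomial_inD f g :
  polynomial_in f -> polynomial_in g -> polynomial_in (fun t => f t + g t).
Proof. by move=> [p fE] [q gE]; exists (p + q) => t; rewrite hornerD fE gE. Qed.

Lemma polynomial_inN f : polynomial_in f -> polynomial_in (fun t => - f t).
Proof. by move=> [p fE]; exists (- p) => t; rewrite hornerN fE. Qed.

Lemma polynomial_inM f g :
  polynomial_in f -> polynomial_in g -> polynomial_in (fun t => f t * g t).
Proof. by move=> [p fE] [q gE]; exists (p * q) => t; rewrite hornerM fE gE. Qed.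

Lemma polynomial_inX f n : polynomial_in f -> polynomial_in (fun t => f t ^+ n).
Proof. by move=> [p fE]; exists (p ^+ n) => t; rewrite horner_exp fE. Qed.

Lemma polynomial_in_sum n (h : 'I_n -> K -> K) :
  (forall i, polynomial_in (h i)) -> polynomial_in (fun t => \sum_(i < n) h i t).
Proof.
move=> /fin_all_exists[p hE]; exists (\sum_(i < n) p i) => t.
by rewrite horner_sum; apply: eq_bigr => i _; apply: hE.
Qed.

Lemma generic_neq0 f t0 : polynomial_in f -> f t0 != 0 ->
  exists S : seq K, forall t, t \notin S -> f t != 0.
Proof.
move=> [p fE] f0; have [S pE] := closed_field_poly_normal p.
have p0 : lead_coef p != 0.
  by rewrite lead_coef_eq0; apply: contraNneq f0 => p0; rewrite fE p0 horner0.
by exists S => t tS; rewrite fE -rootE pE rootZ // root_prod_XsubC.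
Qed.

(** A family whose coefficients are polynomial functions of t is the
    specialization of one polynomial over K[t]; choosing 1 as leading
    coefficient keeps the degree under every specialization, which is what
    resultants require. *)
Lemma monic_family_lift (p : K -> {poly K}) n :
  (forall t, p t \is monic) -> (forall t, size (p t) = n.+1) ->
  (forall i, polynomial_in (fun t => (p t)`_i)) ->
  exists2 L : {poly {poly K}},
    L \is monic & forall t, map_poly (horner_eval t) L = p t.
Proof.
move=> pm sp /boolp.choice[c cE]; exists ('X^n + \poly_(i < n) c i).
  by rewrite monicE lead_coefDl ?lead_coefXn // size_polyXn ltnS size_poly.
move=> t; apply/polyP => i; rewrite coef_map /= horner_evalE coefD coefXn coef_poly.
rewrite hornerD; case: (ltngtP i n) => [lt_in|lt_ni|->].
- by rewrite horner0 add0r cE.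
- by rewrite horner0 addr0 nth_default // sp.
by rewrite hornerC horner0 addr0 -(monicP (pm t)) lead_coefE sp.
Qed.

(** The resultant of the two lifts is a polynomial in t that specializes to the
    resultant of p t and q t. *)
Lemma generic_coprime (p q : K -> {poly K}) n m t0 :
  (forall t, p t \is monic) -> (forall t, size (p t) = n.+1) ->
  (forall i, polynomial_in (fun t => (p t)`_i)) ->
  (forall t, q t \is monic) -> (forall t, size (q t) = m.+1) ->
  (forall i, polynomial_in (fun t => (q t)`_i)) ->
  coprimep (p t0) (q t0) ->
  exists S : seq K, forall t, t \notin S -> coprimep (p t) (q t).
Proof.
move=> pm sp pc qm sq qc c0.
have [L Lm LE] := monic_family_lift pm sp pc.
have [M Mm ME] := monic_family_lift qm sq qc.
have resE t : (resultant L M).[t] = resultant (p t) (q t).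
  rewrite -[_.[t]]/(horner_eval t _) map_resultant ?LE ?ME //.
    by rewrite (monicP Lm) rmorph1 oner_neq0.
  by rewrite (monicP Mm) rmorph1 oner_neq0.
have res_neq0 t : (resultant (p t) (q t) != 0) = coprimep (p t) (q t).
  rewrite resultant_eq0 /coprimep -leqNgt eqn_leq [(0 < _)%N]size_poly_gt0.
  by rewrite gcdp_eq0 negb_and monic_neq0 // andbT.
have resP : polynomial_in (fun t => resultant (p t) (q t)).
  by exists (resultant L M) => t; rewrite resE.
have [|S SP] := generic_neq0 (t0 := t0) resP; first by rewrite res_neq0.
by exists S => t /SP; rewrite res_neq0.
Qed.

Lemma poly_horner_ext (p q : {poly K}) : (forall x, p.[x] = q.[x]) -> p = q.
Proof.
move=> e; apply/eqP; rewrite -subr_eq0; apply/negPn/negP => /closed_nonrootP[x].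
by rewrite rootE hornerD hornerN e subrr eqxx.
Qed.

End Generic.

(* Constants come first, so that numerals are not taken apart. *)
Ltac polynomial_in :=
  repeat match goal with
  | |- polynomial_in (fun t => ?c) => exact (@polynomial_in_cst _ c)
  | |- polynomial_in (fun t => t) => exact (@polynomial_in_id _)
  | |- polynomial_in (fun t => @?f t + @?g t) => refine (@polynomial_inD _ f g _ _)
  | |- polynomial_in (fun t => - @?f t) => refine (@polynomial_inN _ f _)
  | |- polynomial_in (fun t => @?f t * @?g t) => refine (@polynomial_inM _ f g _ _)
  | |- polynomial_in (fun t => @?f t ^+ ?n) => refine (@polynomial_inX _ f n _)
  end.

(** * The family *)

Lemma horner_pencil (R : comNzRingType) (F G H : {poly R}) d x :
  (F ^+ 5 - d *: (G ^+ 3 * H)).[x] = F.[x] ^+ 5 - d * (G.[x] ^+ 3 * H.[x]).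
Proof. by rewrite hornerD hornerN hornerZ horner_exp hornerM horner_exp. Qed.

Section Family.
Variable K : numClosedFieldType.
Implicit Types t x : K.

Lemma monic_Poly_rcons (R : nzRingType) (s : seq R) :
  Poly (rcons s 1) \is monic /\ size (Poly (rcons s 1)) = (size s).+1.
Proof.
have sE : Poly (rcons s 1) = rcons s 1 :> seq R.
  by rewrite (PolyK (c := 1)) // last_rcons oner_neq0.
by rewrite monicE lead_coefE sE size_rcons nth_rcons ltnn !eqxx.
Qed.

Lemma polyFE t : polyF t = Poly (rcons [:: a4 t; a3 t; a2 t; a1 t] 1).
Proof.
rewrite /polyF; move: (a1 t) (a2 t) (a3 t) (a4 t) => a b c d.
by rewrite /= !cons_poly_def mul0r add0r polyC1 -!mul_polyC; ring.
Qed.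

Lemma polyGE t : polyG t = Poly (rcons [:: b5 t; b4 t; b3 t; b2 t; b1 t] 1).
Proof.
rewrite /polyG; move: (b1 t) (b2 t) (b3 t) (b4 t) (b5 t) => a b c d e.
by rewrite /= !cons_poly_def mul0r add0r polyC1 -!mul_polyC; ring.
Qed.

Lemma polyHE t : polyH t = Poly (rcons [:: c3 t; c2 t; c1 t] 1).
Proof.
rewrite /polyH; move: (c1 t) (c2 t) (c3 t) => a b c.
by rewrite /= !cons_poly_def mul0r add0r polyC1 -!mul_polyC; ring.
Qed.

Lemma polynomial_in_coefF i : polynomial_in (fun t => (polyF t)`_i).
Proof.
suff : polynomial_in (fun t => [:: a4 t; a3 t; a2 t; a1 t; 1]`_i).
  by case=> p pE; exists p => t; rewrite -pE polyFE coef_Poly.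
do 5?[case: i => [|i] /=; first by rewrite /a1 /a2 /a3 /a4; polynomial_in].
by rewrite nth_nil; polynomial_in.
Qed.

Lemma polynomial_in_coefG i : polynomial_in (fun t => (polyG t)`_i).
Proof.
suff : polynomial_in (fun t => [:: b5 t; b4 t; b3 t; b2 t; b1 t; 1]`_i).
  by case=> p pE; exists p => t; rewrite -pE polyGE coef_Poly.
do 6?[case: i => [|i] /=; first by rewrite /b1 /b2 /b3 /b4 /b5; polynomial_in].
by rewrite nth_nil; polynomial_in.
Qed.

Lemma polynomial_in_coefH i : polynomial_in (fun t => (polyH t)`_i).
Proof.
suff : polynomial_in (fun t => [:: c3 t; c2 t; c1 t; 1]`_i).
  by case=> p pE; exists p => t; rewrite -pE polyHE coef_Poly.
do 4?[case: i => [|i] /=; first by rewrite /c1 /c2 /c3; polynomial_in].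
by rewrite nth_nil; polynomial_in.
Qed.

Lemma polynomial_in_coefGH i : polynomial_in (fun t => (polyG t * polyH t)`_i).
Proof.
suff : polynomial_in (fun t => \sum_(j < i.+1) (polyG t)`_j * (polyH t)`_(i - j)).
  by case=> p pE; exists p => t; rewrite -pE coefM.
apply: polynomial_in_sum => j.
exact: polynomial_inM (polynomial_in_coefG _) (polynomial_in_coefH _).
Qed.

Lemma horner_polyF t x :
  (polyF t).[x] = x ^+ 4 + a1 t * x ^+ 3 + a2 t * x ^+ 2 + a3 t * x + a4 t.
Proof. by rewrite polyFE horner_Poly /=; ring. Qed.

Lemma horner_polyG t x : (polyG t).[x] =
  x ^+ 5 + b1 t * x ^+ 4 + b2 t * x ^+ 3 + b3 t * x ^+ 2 + b4 t * x + b5 t.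
Proof. by rewrite polyGE horner_Poly /=; ring. Qed.

Lemma horner_polyH t x :
  (polyH t).[x] = x ^+ 3 + c1 t * x ^+ 2 + c2 t * x + c3 t.
Proof. by rewrite polyHE horner_Poly /=; ring. Qed.

Lemma horner_deriv_polyF t x : (polyF t)^`().[x] =
  4 * x ^+ 3 + a1 t * (3 * x ^+ 2) + a2 t * (2 * x) + a3 t.
Proof.
rewrite /polyF; move: (a1 t) (a2 t) (a3 t) (a4 t) => a b c d.
by rewrite !derivE !(hornerD, hornerZ, hornerMn, hornerXn, hornerX, hornerC) /=; ring.
Qed.

Lemma horner_deriv_polyG t x : (polyG t)^`().[x] =
  5 * x ^+ 4 + b1 t * (4 * x ^+ 3) + b2 t * (3 * x ^+ 2) + b3 t * (2 * x) + b4 t.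
Proof.
rewrite /polyG; move: (b1 t) (b2 t) (b3 t) (b4 t) (b5 t) => a b c d e.
by rewrite !derivE !(hornerD, hornerZ, hornerMn, hornerXn, hornerX, hornerC) /=; ring.
Qed.

Lemma horner_deriv_polyH t x : (polyH t)^`().[x] =
  3 * x ^+ 2 + c1 t * (2 * x) + c2 t.
Proof.
rewrite /polyH; move: (c1 t) (c2 t) (c3 t) => a b c.
by rewrite !derivE !(hornerD, hornerZ, hornerMn, hornerXn, hornerX, hornerC) /=; ring.
Qed.

(** The constant D for which F^5 - D G^3 H is a square in x; its zeros are the
    parameters for which the covering degenerates to F^5 = P^2. *)
Definition pencil_coef t : K := 1500 * t ^+ 5 * (t + 2) ^+ 3.

Lemma root_critical_poly t : root (critical_poly (polyF t) (polyG t) (polyH t)) 0.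
Proof.
rewrite /root horner_critical_poly horner_polyF horner_polyG horner_polyH
  horner_deriv_polyF horner_deriv_polyG horner_deriv_polyH.
by apply/eqP; rewrite /a3 /a4 /b4 /b5 /c2 /c3; field.
Qed.

(** A polynomial identity in t and x, verified by expansion.  With the vanishing
    at x = 0 it says that F^5 - D G^3 H is the square of the critical polynomial
    divided by 2 x. *)
Lemma critical_poly_sqr t : critical_poly (polyF t) (polyG t) (polyH t) ^+ 2 =
  (4 *: 'X ^+ 2) * (polyF t ^+ 5 - pencil_coef t *: (polyG t ^+ 3 * polyH t)).
Proof.
apply: poly_horner_ext => x.
rewrite horner_exp horner_critical_poly hornerM hornerZ hornerXn.
rewrite horner_pencil horner_polyF horner_polyG horner_polyH
  horner_deriv_polyF horner_deriv_polyG horner_deriv_polyH.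
rewrite /pencil_coef /a1 /a2 /a3 /a4 /b1 /b2 /b3 /b4 /b5 /c1 /c2 /c3.
by field.
Qed.

(** Two Bezout relations at t = -1, one of F with G and one of F with H, whose
    right-hand sides are nonzero integers.  The factors 5 and 3 clear the
    denominators of G and H. *)
Lemma coprime_polyF_GH_at : coprimep (polyF (-1 : K)) (polyG (-1) * polyH (-1)).
Proof.
apply/Pdiv.ClosedField.coprimepP => x /rootP Fx; rewrite hornerM mulf_neq0 //;
  apply/eqP => Gx.
  have : (14326848%:R + 4639782%:R * x + 617562%:R * x ^+ 2 + 39205%:R * x ^+ 3
          + 975 * x ^+ 4) * (polyF (-1)).[x]
       + 5 * (154560%:R - 12915%:R * x - 4682 * x ^+ 2 - 195 * x ^+ 3)
           * (polyG (-1)).[x] = 2 ^+ 6 * 3 ^+ 5 * 5 ^+ 3.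
    rewrite horner_polyF horner_polyG.
    by rewrite /a1 /a2 /a3 /a4 /b1 /b2 /b3 /b4 /b5; field.
  by rewrite Fx Gx !mulr0 addr0 => /esym/eqP; apply/negP;
    rewrite !mulf_neq0 ?expf_neq0 ?pnatr_eq0.
have : (6 - 9 * x + 3 * x ^+ 2) * (polyF (-1)).[x]
     + 3 * (810 - 65 * x - 24 * x ^+ 2 - x ^+ 3) * (polyH (-1)).[x] =
    2 ^+ 6 * 3 ^+ 3 * 5.
  by rewrite horner_polyF horner_polyH /a1 /a2 /a3 /a4 /c1 /c2 /c3; field.
by rewrite Fx Gx !mulr0 addr0 => /esym/eqP; apply/negP;
    rewrite !mulf_neq0 ?expf_neq0 ?pnatr_eq0.
Qed.

Lemma monic_polyF t : polyF t \is monic.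
Proof. by rewrite polyFE (monic_Poly_rcons _).1. Qed.
Lemma size_polyF t : size (polyF t) = 5%N.
Proof. by rewrite polyFE (monic_Poly_rcons _).2. Qed.
Lemma monic_polyG t : polyG t \is monic.
Proof. by rewrite polyGE (monic_Poly_rcons _).1. Qed.
Lemma size_polyG t : size (polyG t) = 6%N.
Proof. by rewrite polyGE (monic_Poly_rcons _).2. Qed.
Lemma monic_polyH t : polyH t \is monic.
Proof. by rewrite polyHE (monic_Poly_rcons _).1. Qed.
Lemma size_polyH t : size (polyH t) = 4%N.
Proof. by rewrite polyHE (monic_Poly_rcons _).2. Qed.

Lemma horner0_polyF t : (polyF t).[0] = a4 t.
Proof. by rewrite horner_polyF; ring. Qed.
Lemma horner0_polyG t : (polyG t).[0] = b5 t.
Proof. by rewrite horner_polyG; ring. Qed.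
Lemma horner0_polyH t : (polyH t).[0] = c3 t.
Proof. by rewrite horner_polyH; ring. Qed.

(** The last factor is P(0)^2. *)
Definition nondegeneracy t : K :=
  pencil_coef t * a4 t * b5 t * c3 t * (a4 t ^+ 5 - pencil_coef t * (b5 t ^+ 3 * c3 t)).

Lemma generic_nondegeneracy :
  exists S : seq K, forall t, t \notin S -> nondegeneracy t != 0.
Proof.
apply: (@generic_neq0 _ _ (-1)).
  by rewrite /nondegeneracy /pencil_coef /a4 /b5 /c3; polynomial_in.
have DE : pencil_coef (-1 : K) = - 1500 by rewrite /pencil_coef; ring.
have aE : a4 (-1 : K) = - (9 * 1055) by rewrite /a4; ring.
have bE : b5 (-1 : K) = 2 * 3 ^+ 5 * 1811 / 5 by rewrite /b5; field.
have cE : c3 (-1 : K) = 27 by rewrite /c3; field.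
have PE : a4 (-1) ^+ 5 - pencil_coef (-1) * (b5 (-1) ^+ 3 * c3 (-1)) =
    (3 ^+ 5 * 5347%:R * 9227%:R) ^+ 2 :> K.
  by rewrite DE aE bE cE; field.
rewrite /nondegeneracy PE DE aE bE cE.
by rewrite !mulf_neq0 ?oppr_eq0 ?expf_neq0 ?mulf_neq0 ?invr_eq0 ?pnatr_eq0 ?expf_neq0.
Qed.

Lemma generic_coprime_polyF :
  exists S : seq K, forall t, t \notin S -> coprimep (polyF t) (polyG t * polyH t).
Proof.
apply: (@generic_coprime _ _ _ 4 8 (-1)).
- exact: monic_polyF.
- exact: size_polyF.
- exact: polynomial_in_coefF.
- by move=> t; rewrite monicMl ?monic_polyG ?monic_polyH.
- move=> t; rewrite size_Mmonic ?monic_polyH ?monic_neq0 ?monic_polyG //.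
  by rewrite size_polyG size_polyH.
- exact: polynomial_in_coefGH.
- exact: coprime_polyF_GH_at.
Qed.

Lemma critical_poly_factor t :
  exists p, critical_poly (polyF t) (polyG t) (polyH t) = 2 *: ('X * p).
Proof.
have := root_critical_poly t; rewrite -dvdp_XsubCl subr0 => /dvdpP[q ->].
by exists (2^-1 *: q); rewrite -scalerAr scalerA divff ?pnatr_eq0 // scale1r mulrC.
Qed.

(** Cancel 4 x^2 in [critical_poly_sqr]. *)
Lemma square_of_critical_factor t (p : {poly K}) :
  critical_poly (polyF t) (polyG t) (polyH t) = 2 *: ('X * p) ->
  polyF t ^+ 5 - pencil_coef t *: (polyG t ^+ 3 * polyH t) = p ^+ 2.
Proof.
move=> pE; have X2_neq0 : 4 *: 'X ^+ 2 != 0 :> {poly K}.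
  by rewrite scaler_eq0 negb_or pnatr_eq0 expf_neq0 ?polyX_eq0.
apply: (mulfI X2_neq0); rewrite -critical_poly_sqr pE exprZn exprMn scalerAl.
by rewrite -natrX.
Qed.

(** Since F^5 is monic of degree 20 and G^3 H has degree 18, a square root has
    degree 10 and leading coefficient 1 or -1. *)
Lemma lead_square_root t (p : {poly K}) :
  polyF t ^+ 5 - pencil_coef t *: (polyG t ^+ 3 * polyH t) = p ^+ 2 ->
  size p = 11%N /\ lead_coef p ^+ 2 = 1.
Proof.
move=> pE; have F0 := monic_neq0 (monic_polyF t).
have G0 := monic_neq0 (monic_polyG t); have H0 := monic_neq0 (monic_polyH t).
have szF : size (polyF t ^+ 5) = 21%N by rewrite size_expS // size_polyF.
have szGH : (size (- (pencil_coef t *: (polyG t ^+ 3 * polyH t)))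
             < size (polyF t ^+ 5))%N.
  rewrite size_polyN szF; apply: leq_ltn_trans (size_scale_leq _ _) _.
  by rewrite size_mul ?expf_neq0 // size_expS // size_polyG size_polyH.
have sz2 : size (p ^+ 2) = 21%N by rewrite -pE size_polyDl // szF.
have p0 : p != 0 by apply: contra_eq_neq sz2 => ->; rewrite expr0n size_poly0.
split.
  move: sz2; rewrite size_expS //; case: (size p) => //= n [] /eqP.
  by rewrite (@eqn_mul2r 2 n 10) => /eqP->.
by rewrite -lead_coef_exp -pE lead_coefDl // (monicP (monic_exp _ (monic_polyF t))).
Qed.

(** The argument is algebraic; the complex numbers enter as an algebraically
    closed field of characteristic 0. *)
Lemma generic_covering :
  exists S : seq K, forall t : K, t \notin S ->
  exists C0 : K, exists P : {poly K},
    [/\ C0 != 0, P \is monic & size P = 11%N] /\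
    [/\ phi20 C0 t - 1 =
          C0%:P%:F * (P%:F ^+ 2 / ((polyG t)%:F ^+ 3 * (polyH t)%:F)),
        R4_pattern 20 [:: 5; 5; 5; 5]%N
          [:: 2; 2; 2; 2; 2; 2; 2; 2; 2; 2]%N
          [:: 3; 3; 3; 3; 3; 2; 1; 1; 1]%N (phi20 C0 t),
        reval (phi20 C0 t) None = None,
        ramord (phi20 C0 t) None = 2%N
      & extra_ramification_point (phi20 C0 t) (Some 0)].
Proof.
have [S1 S1P] := generic_nondegeneracy.
have [S2 S2P] := generic_coprime_polyF.
exists (S1 ++ S2) => t; rewrite mem_cat negb_or => /andP[/S1P nd /S2P cop].
have nz (x y : K) : x * y != 0 -> x != 0 /\ y != 0.
  by rewrite mulf_eq0 negb_or => /andP.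
move: nd => /nz[/nz[/nz[/nz[D0 A0] B0] E0] P0].
have [p critE] := critical_poly_factor t.
have pE := square_of_critical_factor critE.
have [szp leadp] := lead_square_root pE.
set C0 := (pencil_coef t)^-1; have C0_neq0 : C0 != 0 by rewrite invr_eq0.
set num := C0 *: polyF t ^+ 5; set den := polyG t ^+ 3 * polyH t.
have denE : (polyG t)%:F ^+ 3 * (polyH t)%:F = den%:F.
  by rewrite [RHS]tofracM tofracXn.
have phiE : phi20 C0 t = num%:F / den%:F.
  by rewrite /phi20 denE mulrA -tofracXn -tofracM mul_polyC.
have sqE : num - den = C0 *: p ^+ 2.
  by rewrite -pE scalerBr scalerA mulVf // scale1r.
have F0 : ~~ root (polyF t) 0 by rewrite rootE horner0_polyF.
have G0 : ~~ root (polyG t) 0 by rewrite rootE horner0_polyG.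
have H0 : ~~ root (polyH t) 0 by rewrite rootE horner0_polyH.
have p0 : ~~ root p 0.
  rewrite -(root_expS p 1) rootE -pE horner_pencil.
  by rewrite horner0_polyF horner0_polyG horner0_polyH.
have sF := size_polyF t; have sG := size_polyG t; have sH := size_polyH t.
have den0 : den != 0.
  by rewrite mulf_neq0 ?expf_neq0 // monic_neq0 ?monic_polyG ?monic_polyH.
have lead0 : lead_coef p != 0 by rewrite lead_coef_eq0 -size_poly_eq0 szp.
(* The factor normalizes the sign of p without changing its square. *)
exists C0, (lead_coef p *: p); split.
  split=> //; last by rewrite size_scale.
  by rewrite monicE lead_coefZ -expr2 leadp.
split.
- rewrite phiE denE -tofracXn exprZn leadp scale1r mulrA -tofracM mul_polyC.
  by rewrite -sqE tofracB mulrBl divff ?tofrac_eq0.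
- rewrite phiE; exact: (@R4_pattern_phi _ _ _ _ p).
- rewrite phiE; exact: reval_infty.
- rewrite phiE; exact: ramord_infty.
- rewrite phiE; exact: (@extra_point_zero _ _ _ _ p).
Qed.

End Family.

Theorem mainTheorem3 (R : realType) :
  exists S : seq R[i], forall t : R[i], t \notin S ->
  exists C0 : R[i], exists P : {poly R[i]},
    [/\ C0 != 0, P \is monic & size P = 11%N] /\
    [/\ phi20 C0 t - 1 =
          C0%:P%:F * (P%:F ^+ 2 / ((polyG t)%:F ^+ 3 * (polyH t)%:F)),
        R4_pattern 20 [:: 5; 5; 5; 5]%N
          [:: 2; 2; 2; 2; 2; 2; 2; 2; 2; 2]%N
          [:: 3; 3; 3; 3; 3; 2; 1; 1; 1]%N (phi20 C0 t),
        reval (phi20 C0 t) None = None,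
        ramord (phi20 C0 t) None = 2%N
      & extra_ramification_point (phi20 C0 t) (Some 0)].
Proof. exact: generic_covering. Qed.
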